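(* Let $(\Omega,\Sigma,\mathbb{P})$ be a nonatomic probability space and let $\mathcal{K}$ be a convex bounded set in $\mathbb{L}^1(\mathbb{P})$. The following are equivalent. (1) The $\mathbb{L}^0(\mathbb{P})$-topology on $\mathcal{K}$ is uniformly locally convex-solid on $\mathcal{K}$. (2) There exists a probability measure $\mathbb{Q}\sim\mathbb{P}$ such that the $\mathbb{L}^0(\mathbb{Q})$- and $\mathbb{L}^1(\mathbb{Q})$-topologies agree on $\mathcal{K}$.
   Context: $\mathbb{L}^0(\mathbb{P})$ is the space of all real random variables on $(\Omega,\Sigma)$ modulo a.s. equality; the $\mathbb{L}^0(\mathbb{P})$-topology is the topology of convergence in probability. Bounded in $\mathbb{L}^1(\mathbb{P})$ means $\sup_{X\in\mathcal{K}}\mathbb{E}_{\mathbb{P}}[|X|]<\infty$. $\mathbb{Q}\sim\mathbb{P}$ means that $\mathbb{Q}$ is a probability measure on $(\Omega,\Sigma)$ mutually absolutely continuous with $\mathbb{P}$; then $\mathbb{L}^0(\mathbb{Q})=\mathbb{L}^0(\mathbb{P})$ with the same topology. That the $\mathbb{L}^0(\mathbb{Q})$- and $\mathbb{L}^1(\mathbb{Q})$-topologies agree on $\mathcal{K}$ means that $\mathcal{K}\subseteq\mathbb{L}^1(\mathbb{Q})$ and the relative topologies on $\mathcal{K}$ inherited from $\mathbb{L}^0(\mathbb{Q})$ and from the norm of $\mathbb{L}^1(\mathbb{Q})$ coincide. A set $\mathcal{W}\subseteq\mathbb{L}^0(\mathbb{P})$ is solid if $Y\in\mathcal{W}$ whenever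 there is $X\in\mathcal{W}$ with $|Y|\le|X|$; it is convex-solid if it is convex and solid. For a nonempty subset $\mathcal{S}\subseteq\mathcal{K}$, the $\mathbb{L}^0(\mathbb{P})$-topology on $\mathcal{K}$ is uniformly locally convex-solid on $\mathcal{S}$ if for every $\mathbb{L}^0(\mathbb{P})$-neighborhood $\mathcal{U}$ of $0$ there exists a convex-solid set $\mathcal{W}\subseteq\mathcal{U}$ such that, for every $X\in\mathcal{S}$, $(X+\mathcal{W})\cap\mathcal{K}$ is a neighborhood of $X$ in the relative $\mathbb{L}^0(\mathbb{P})$-topology on $\mathcal{K}$. *)

(* Defs.v *)
From HB Require Import structures.
From mathcomp Require Import all_boot all_order all_algebra.
From mathcomp Require Import all_classical all_reals all_analysis.
From mathcomp Require Import measurable_realfun.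

Set Implicit Arguments.
Unset Strict Implicit.
Unset Printing Implicit Defensive.

Import Order.TTheory GRing.Theory Num.Theory.
Import numFieldNormedType.Exports.

Local Open Scope classical_set_scope.
Local Open Scope ring_scope.

(* Elements of L0 P are classes of real random variables modulo P-a.s. equality;
   an X : L0 P coerces to a representative.  The vector space operations below
   are those induced by the pointwise operations on random variables. *)
Definition L0 (d : measure_display) (T : measurableType d) (R : realType)
  (P : probability T R) : Type := {mfun_ P, T >-> R}.

Section L0_lmodule.
Context (d : measure_display) (T : measurableType d) (R : realType).
Variable P : probability T R.
Implicit Types (X Y Z : L0 P) (f g h : {mfun T >-> R}) (a b : R).

HB.instance Definition _ := Choice.on (L0 P).

Definition L0_pi f : L0 P := \pi_({mfun_ P, T >-> R})%qT f.
Definition L0_repr X : {mfun T >-> R} := repr X.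
Coercion L0_repr : L0 >-> MeasurableFun.type.

Lemma L0_reprK X : L0_pi (L0_repr X) = X.
Proof. exact: reprK. Qed.

Lemma L0_piP f g : f = g %[ae P] -> L0_pi f = L0_pi g.
Proof. by move=> fg; apply/eqmodP/asboolP. Qed.

Lemma L0_piK f : L0_repr (L0_pi f) = f %[ae P].
Proof.
have /eqmodP/asboolP := L0_reprK (L0_pi f).
exact.
Qed.

Lemma L0_eqP X Y : L0_repr X = L0_repr Y %[ae P] -> X = Y.
Proof. by move=> /L0_piP; rewrite !L0_reprK. Qed.

Definition L0_zero : L0 P := L0_pi 0.
Definition L0_opp X : L0 P := L0_pi (- L0_repr X).
Definition L0_add X Y : L0 P := L0_pi (L0_repr X + L0_repr Y).
Definition L0_scale a X : L0 P := L0_pi (a *: L0_repr X).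

Lemma L0_piN f : L0_opp (L0_pi f) = L0_pi (- f).
Proof.
apply: L0_piP; apply: filterS (L0_piK f) => w /(_ I) e _.
by change (- L0_pi f w = - f w); rewrite e.
Qed.

Lemma L0_piD f g : L0_add (L0_pi f) (L0_pi g) = L0_pi (f + g).
Proof.
apply: L0_piP; apply: filterS2 (L0_piK f) (L0_piK g) => w /(_ I) e1 /(_ I) e2 _.
by change (L0_pi f w + L0_pi g w = f w + g w); rewrite e1 e2.
Qed.

Lemma L0_piZ a f : L0_scale a (L0_pi f) = L0_pi (a *: f).
Proof.
apply: L0_piP; apply: filterS (L0_piK f) => w /(_ I) e _.
by change (a * L0_pi f w = a * f w); rewrite e.
Qed.

Let addA : associative L0_add.
Proof.
move=> X Y Z; rewrite -[X]L0_reprK -[Y]L0_reprK -[Z]L0_reprK.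
by rewrite !L0_piD addrA.
Qed.

Let addC : commutative L0_add.
Proof. by move=> X Y; rewrite /L0_add addrC. Qed.

Let add0 : left_id L0_zero L0_add.
Proof. by move=> X; rewrite -[X]L0_reprK L0_piD add0r. Qed.

Let addN : left_inverse L0_zero L0_opp L0_add.
Proof. by move=> X; rewrite -[X]L0_reprK L0_piN L0_piD addNr. Qed.

HB.instance Definition _ := GRing.isZmodule.Build (L0 P) addA addC add0 addN.

Let scaleA a b X : L0_scale a (L0_scale b X) = L0_scale (a * b) X.
Proof. by rewrite -[X]L0_reprK !L0_piZ scalerA. Qed.

Let scale1 : left_id 1 L0_scale.
Proof. by move=> X; rewrite -[X]L0_reprK L0_piZ scale1r. Qed.

Let scaleDr : right_distributive L0_scale +%R.
Proof.
move=> a X Y; rewrite -[X]L0_reprK -[Y]L0_reprK.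
rewrite -[+%R]/L0_add.
by rewrite !(L0_piZ, L0_piD) scalerDr.
Qed.

Let scaleDl X : {morph L0_scale^~ X : a b / a + b}.
Proof.
by move=> a b; rewrite -[+%R in RHS]/L0_add -[X]L0_reprK !(L0_piZ, L0_piD) scalerDl.
Qed.

HB.instance Definition _ :=
  GRing.Zmodule_isLmodule.Build R (L0 P) scaleA scale1 scaleDr scaleDl.

Lemma L0_repr0 : (0 : L0 P) = cst 0 %[ae P].
Proof. exact: (L0_piK 0). Qed.

Lemma L0_reprN X : (- X : L0 P) = \- X %[ae P].
Proof. exact: L0_piK. Qed.

Lemma L0_reprD X Y : (X + Y : L0 P) = X \+ Y %[ae P].
Proof. exact: L0_piK. Qed.

Lemma L0_reprZ a X : (a *: X : L0 P) = a \*o X %[ae P].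
Proof. exact: L0_piK. Qed.




End L0_lmodule.

Section L0_topology.
Context (d : measure_display) (T : measurableType d) (R : realType).
Variable P : probability T R.
Implicit Types (X Y Z : L0 P) (e : R).

(* These balls generate the topology of convergence in probability, see L0_cvgP:
   the sets { P(|X - Y| >= e) < e' } with e <> e' give the same topology. *)
Definition L0_ball X e : set (L0 P) :=
  [set Y | (P [set w | (e <= `|X w - Y w|)%R] < e%:E)%E].

Lemma measurable_L0_dist X Y e : measurable [set w | e <= `|X w - Y w|].
Proof.
have mf : measurable_fun setT (fun w => `|X w - Y w|).
  by apply: measurableT_comp => //; exact: measurable_funB.
rewrite (_ : mkset _ = setT `&` (fun w => `|X w - Y w|) @^-1` `[e, +oo[).
  exact: mf.
by rewrite setTI; apply/seteqP; split=> w /=; rewrite in_itv/= andbT.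
Qed.

Let L0_ball_center X e : 0 < e -> L0_ball X e X.
Proof.
move=> e0; rewrite /L0_ball/= (_ : mkset _ = set0) ?measure0 ?lte_fin//.
apply/seteqP; split=> w //=.
by rewrite subrr normr0 leNgt e0.
Qed.

Let L0_ball_sym X Y e : L0_ball X e Y -> L0_ball Y e X.
Proof.
rewrite /L0_ball/=; congr (P _ < _)%E.
by apply/seteqP; split=> w /=; rewrite distrC.
Qed.

Let L0_ball_triangle X Y Z e1 e2 :
  L0_ball X e1 Y -> L0_ball Y e2 Z -> L0_ball X (e1 + e2) Z.
Proof.
rewrite /L0_ball/= => XY YZ; rewrite EFinD.
apply: le_lt_trans (lteD XY YZ).
apply: le_trans (measureU2 _ _ _); try exact: measurable_L0_dist.
apply: le_measure; rewrite ?inE.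
- exact: measurable_L0_dist.
- by apply: measurableU; exact: measurable_L0_dist.
move=> w /= h; apply/orP; rewrite -implyNb -ltNge; apply/implyP => XYw.
rewrite leNgt; apply/negP => YZw; move: h; apply/negP; rewrite -ltNge.
by rewrite (le_lt_trans (ler_distD (Y w) _ _))// ltrD.
Qed.

HB.instance Definition _ := hasNbhs.Build (L0 P) (nbhs_ (entourage_ L0_ball)).

HB.instance Definition _ := @Nbhs_isPseudoMetric.Build R (L0 P)
  (entourage_ L0_ball) erefl L0_ball
  L0_ball_center L0_ball_sym L0_ball_triangle erefl.

Lemma L0_cvgP (F : set_system (L0 P)) (FF : Filter F) X :
  F --> X <-> forall e, 0 < e ->
    (fun Y : L0 P => P [set w | (e <= `|X w - Y w|)%R]) @ F --> 0%E.
Proof.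
split=> [FX e e0|FX].
- apply/fine_cvgP; split.
    by apply: nearW => Y; rewrite fin_num_measure//; exact: measurable_L0_dist.
  apply/cvgr0Pnorm_lt => r r0.
  have m0 : 0 < Num.min e r by rewrite lt_min e0 r0.
  have /fcvg_ballP/(_ _ m0) := FX.
  apply: filterS => Y; rewrite /ball/= /L0_ball/= => XY.
  rewrite ger0_norm ?fine_ge0// -lte_fin fineK; last first.
    by rewrite fin_num_measure//; exact: measurable_L0_dist.
  apply: le_lt_trans (lt_le_trans XY _); last by rewrite lee_fin ge_min lexx orbT.
  apply: le_measure; rewrite ?inE; try exact: measurable_L0_dist.
  by move=> w /=; apply: le_trans; rewrite ge_min lexx.
- apply/fcvg_ballP => e e0.
  have /fine_cvgP[_ /cvgr0Pnorm_lt/(_ _ e0)] := FX _ e0.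
  apply: filterS => Y; rewrite /ball/= /L0_ball/=.
  rewrite ger0_norm ?fine_ge0// -lte_fin fineK//.
  by rewrite fin_num_measure//; exact: measurable_L0_dist.
Qed.

End L0_topology.

Section L1.
Context (d : measure_display) (T : measurableType d) (R : realType).
Variable P : probability T R.

Definition L1_pred : {pred L0 P} := fun X => finite_norm P 1 X.

Lemma L1_norm_ae (f g : {mfun T >-> R}) : f = g %[ae P] ->
  'N[P]_1[EFin \o f]%E = 'N[P]_1[EFin \o g]%E.
Proof.
move=> fg; rewrite !Lnorm1; apply: ge0_ae_eq_integral => //.
- by do 2 apply: measurableT_comp => //.
- by do 2 apply: measurableT_comp => //.
by apply: filterS fg => w /(_ I) /= -> _.
Qed.

Lemma L1_normZ a (X : L0 P) :
  'N[P]_1[EFin \o (a *: X : L0 P)]%E = (`|a|%:E * 'N[P]_1[EFin \o X])%E.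
Proof.
rewrite (@L1_norm_ae _ (a *: L0_repr X) (L0_reprZ a X)) !Lnorm1 -ge0_integralZl//; last first.
  by do 2 apply: measurableT_comp => //.
by apply: eq_integral => w _ /=; rewrite -EFinM -normrM.
Qed.

Lemma L1_normD (X Y : L0 P) :
  ('N[P]_1[EFin \o (X + Y : L0 P)%R] <=
   'N[P]_1[EFin \o X] + 'N[P]_1[EFin \o Y])%E.
Proof.
by rewrite (@L1_norm_ae _ (L0_repr X + L0_repr Y) (L0_reprD X Y)); apply: eminkowski.
Qed.

Lemma L1_submod_closed : submod_closed L1_pred.
Proof.
split.
  change (finite_norm P 1 (0 : L0 P)).
  by rewrite /finite_norm (@L1_norm_ae _ 0 (L0_repr0 P)) Lnorm0//.
move=> a X Y X1 Y1; change (finite_norm P 1 (a *: X + Y : L0 P)).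
apply: le_lt_trans (L1_normD _ _) _; rewrite L1_normZ lte_add_pinfty//.
by rewrite lte_mul_pinfty// ?lee_fin.
Qed.

HB.instance Definition _ := GRing.isSubmodClosed.Build R (L0 P) L1_pred
  L1_submod_closed.

(* L1 P as a linear subspace of L0 P, normed by E_P[|X|]. *)
Record L1 := MkL1 { L1val : L0 P ; L1valP : L1val \in L1_pred }.

HB.instance Definition _ := [isSub for L1val].
HB.instance Definition _ := [Choice of L1 by <:].
HB.instance Definition _ := [SubChoice_isSubLmodule of L1 by <:].

Definition L1_norm (X : L1) : R := fine 'N[P]_1[EFin \o L1val X].

Lemma L1_normE X : (L1_norm X)%:E = 'N[P]_1[EFin \o L1val X]%E.
Proof.
by rewrite /L1_norm fineK// ge0_fin_numE ?Lnorm_ge0//; exact: (L1valP X).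
Qed.

Let L1_norm_triangle X Y : L1_norm (X + Y) <= L1_norm X + L1_norm Y.
Proof. by rewrite -lee_fin EFinD !L1_normE; exact: L1_normD. Qed.

Let L1_norm_scale a X : L1_norm (a *: X) = `|a| * L1_norm X.
Proof. by apply: EFin_inj; rewrite EFinM !L1_normE; exact: L1_normZ. Qed.

Let L1_norm_eq0 X : L1_norm X = 0 -> X = 0.
Proof.
move=> X0; apply: val_inj; apply: L0_eqP => /=.
have N0 : 'N[P]_1[EFin \o L1val X]%E = 0%E by rewrite -L1_normE X0.
have mX : measurable_fun setT (EFin \o L1val X) by exact/measurable_EFinP.
have Xae := Lnorm_eq0_eq0 mX lte01 N0.
apply: filterS2 Xae (L0_repr0 P) => w /(_ I) [Xw] /(_ I) e _.
by rewrite e Xw.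
Qed.

HB.instance Definition _ := Lmodule_isNormed.Build R L1
  L1_norm_triangle L1_norm_scale L1_norm_eq0.

End L1.

(* For Q equivalent to P this is the identification of L0 P with L0 Q (both are
   quotients of the same space of random variables by the same relation, but
   they are distinct types). *)
Definition L0_change (d : measure_display) (T : measurableType d)
  (R : realType) (P Q : probability T R) (X : L0 P) : L0 Q := L0_pi Q X.

Lemma L0_change_pi (d : measure_display) (T : measurableType d) (R : realType)
    (P Q : probability T R) (f : {mfun T >-> R}) :
  Q `<< P -> L0_change Q (L0_pi P f) = L0_pi Q f.
Proof.
move=> QP; apply: L0_piP.
exact: (null_dominates_ae_eq measurableT QP (L0_piK P f)).
Qed.

Definition nonatomic (d : measure_display) (T : measurableType d)
    (R : realType) (P : probability T R) :=
  forall A : set T, measurable A -> (0 < P A)%E ->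
    exists B : set T, [/\ measurable B, B `<=` A, (0 < P B)%E & (P B < P A)%E].

Section convex_solid.
Context (d : measure_display) (T : measurableType d) (R : realType).
Variable P : probability T R.

Definition L1_bounded (K : set (L0 P)) :=
  (ereal_sup [set 'E_P[fun w => `|X w|%R] | X in K] < +oo)%E.

Definition solid (W : set (L0 P)) :=
  forall X Y : L0 P, W X -> (\forall w \ae P, `|Y w| <= `|X w|) -> W Y.

Definition convex_solid (W : set (L0 P)) := @convex_set R (L0 P) W /\ solid W.

Definition uniformly_locally_convex_solid (K S : set (L0 P)) :=
  forall U : set (L0 P), nbhs (0 : L0 P) U ->
    exists W : set (L0 P), [/\ convex_solid W, W `<=` U &
      forall X, S X -> within K (nbhs X) ([set X + Z | Z in W] `&` K)].

(* A ranges over all sets, so the equivalence says that the two families of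
   relatively open subsets of K are equal. *)
Definition L0_L1_topologies_agree (K : set (L0 P)) :=
  K `<=` range (@L1val d T R P) /\
  forall A : set (L0 P),
    (exists2 U : set (L0 P), open U & A = U `&` K) <->
    (exists2 V : set (L1 P), open V & A = (@L1val d T R P @` V) `&` K).

End convex_solid.

(* Main.v *)
Require Import Defs.
From HB Require Import structures.
From mathcomp Require Import all_boot all_order all_algebra.
From mathcomp Require Import all_classical all_reals all_analysis.
From mathcomp Require Import ring lra measurable_realfun.

(** (2) implies (1): small balls of L1(Q) are convex and solid, are contained in
    prescribed neighborhoods of 0 by Markov's inequality, and their translates
    are relatively open in K because the two topologies agree there.

    (1) implies (2): let W be convex-solid with P(|X| >= e) < e on W.  Then there
    is an event A with P(A^c) <= 2e and E[1_A |X|] <= 40e for every X in W.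
    Indeed, the functional f |-> E[1/(1+f)] is strictly convex on the nonnegative
    part of W/e, so that a sequence X_n of fast near-minimizers is almost surely
    Cauchy after composition with x |-> 1/(1+x); A is an event on which all X_n
    are bounded by 3, and near-minimality of X_n, tested in the direction of
    min(f, n+1), bounds E[1_A min(f, n+1)] independently of n.
    Apply this with e = 2^-n to sets W_n given by (1), and let Q have density
    proportional to g = inf_n (1 on A_n, 2^-n elsewhere), which is almost surely
    positive by Borel-Cantelli.  Since g <= 1_{A_n} + 2^-n, on the set of Y in K
    with Y - X in W_n one gets E_Q|X - Y| <= c 2^-n (40 + 2 sup_K E_P|X|). *)

Set Implicit Arguments.
Unset Strict Implicit.
Unset Printing Implicit Defensive.

Import Order.TTheory GRing.Theory Num.Theory.
Import numFieldNormedType.Exports.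

Local Open Scope classical_set_scope.
Local Open Scope ring_scope.

(** * Convexity estimates for the function 1/(1+x) on the nonnegative half-line *)

Section recip.
Context {R : realType}.
Implicit Types a b t s N : R.

(** Quantitative strict convexity. With [u] and [v] the values at [a] and [b], the value at the
    midpoint is their harmonic mean, and the arithmetic mean exceeds it by exactly
    [(u - v) ^+ 2 / (2 * (u + v))], where [u + v <= 2]. *)
Lemma recip_midpoint a b s : 0 <= a -> 0 <= b -> 0 <= s ->
  s <= `|(1 + a)^-1 - (1 + b)^-1| ->
  (1 + (2^-1 * a + (1 - 2^-1) * b))^-1 + s ^+ 2 / 4 <= 2^-1 * (1 + a)^-1 + 2^-1 * (1 + b)^-1.
Proof.
move=> a0 b0 s0 sab.
set u := (1 + a)^-1; set v := (1 + b)^-1.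
have u0 : 0 < u by rewrite invr_gt0; lra.
have v0 : 0 < v by rewrite invr_gt0; lra.
have u1 : u <= 1 by rewrite invf_le1; lra.
have v1 : v <= 1 by rewrite invf_le1; lra.
have E : (1 + (2^-1 * a + (1 - 2^-1) * b))^-1 = 2 * u * v / (u + v).
  by rewrite /u /v; field; rewrite !gt_eqF//; lra.
have s2 : s ^+ 2 <= (u - v) ^+ 2.
  by rewrite -[leRHS]real_normK ?num_real// lerXn2r ?nnegrE.
have -> : 2^-1 * u + 2^-1 * v = 2 * u * v / (u + v) + (u - v) ^+ 2 / (2 * (u + v)).
  by field; rewrite gt_eqF//; lra.
rewrite E lerD2l (le_trans (ler_wpM2r _ s2)) ?invr_ge0//.
rewrite ler_wpM2l ?sqr_ge0// lef_pV2 ?posrE; lra.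
Qed.

(** First-order comparison for a step of length [t] from [a] towards [b]. The increment is exactly
    [t * (b - a) * w] with [w] the inverse of [(1 + a) * (1 + Z)]; since [a * w <= 1], the part
    coming from [a] costs at most [t]. *)
Lemma recip_tangent a b t c : 0 <= a -> 0 <= b -> 0 <= t <= 1 ->
  c <= ((1 + a) * (1 + (t * b + (1 - t) * a)))^-1 ->
  (1 + (t * b + (1 - t) * a))^-1 + t * (c * b) <= (1 + a)^-1 + t.
Proof.
move=> a0 b0 /andP[t0 t1]; set Z := t * b + (1 - t) * a => cZ.
have Z0 : 0 <= Z by rewrite addr_ge0// mulr_ge0// subr_ge0.
have -> : (1 + a)^-1 = (1 + Z)^-1 + t * (b - a) * ((1 + a) * (1 + Z))^-1.
  have -> : t * (b - a) = (1 + Z) - (1 + a) by rewrite /Z; ring.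
  by field; rewrite !gt_eqF//; lra.
set w := ((1 + a) * (1 + Z))^-1 in cZ *.
have aw : a * w <= 1 by rewrite ler_pdivrMr ?mulr_gt0; nra.
have p1 : t * (c * b) <= t * (w * b) by rewrite ler_wpM2l// ler_wpM2r.
have p2 : 0 <= t * (1 - a * w) by apply: mulr_ge0; rewrite ?subr_ge0.
lra.
Qed.

End recip.

(** * Integral bounds off a small event for convex families stable under truncation *)

Section convex_truncation.
Context (d : measure_display) (T : measurableType d) (R : realType).
Variable P : probability T R.
Implicit Types f g : T -> R.

Lemma ge0_integral_lincomb (a b : R) f g : 0 <= a -> 0 <= b ->
  measurable_fun setT f -> measurable_fun setT g ->
  (forall x, 0 <= f x) -> (forall x, 0 <= g x) ->
  (\int[P]_x (a * f x + b * g x)%:E =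
   a%:E * \int[P]_x (f x)%:E + b%:E * \int[P]_x (g x)%:E)%E.
Proof.
move=> a0 b0 mf mg f0 g0.
rewrite -!ge0_integralZl ?lee_fin//; try exact/measurable_EFinP.
rewrite -ge0_integralD//.
- by move=> x _; rewrite -EFinM lee_fin mulr_ge0.
- by apply: measurable_funeM; exact/measurable_EFinP.
- by move=> x _; rewrite -EFinM lee_fin mulr_ge0.
- by apply: measurable_funeM; exact/measurable_EFinP.
- by move=> x _; rewrite lee_fin.
- by move=> x _; rewrite lee_fin.
Qed.

Let I f := (\int[P]_x ((1 + f x)^-1)%:E)%E.

Let measurable_recip f : measurable_fun setT f -> (forall x, 0 <= f x) ->
  measurable_fun setT (fun x => (1 + f x)^-1).
Proof.
move=> mf f0; rewrite (_ : (fun x => _) = (fun x => (1 + f x) `^ (-1))).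
  apply: (measurableT_comp (measurable_powR _)).
  exact: measurable_funD.
by apply/funext => x; rewrite powR_inv1// addr_ge0.
Qed.

Let I_ge0 f : (forall x, 0 <= f x) -> (0 <= I f)%E.
Proof. by move=> f0; apply: integral_ge0 => x _; rewrite lee_fin invr_ge0 addr_ge0. Qed.

Let I_le1 f : measurable_fun setT f -> (forall x, 0 <= f x) -> (I f <= 1)%E.
Proof.
move=> mf f0; rewrite -(probability_setT P) -[leRHS]mul1e -integral_cst//.
apply: ge0_le_integral => //.
- by move=> x _; rewrite lee_fin invr_ge0 addr_ge0.
- by apply/measurable_EFinP; exact: measurable_recip.
- by move=> x _; rewrite lee_fin invf_le1 ?ltr_pwDl// lerDl.
Qed.

(** Stability under [Num.min] makes the truncations of [f] admissible competitors in the
    minimization of [I]; their integrals over [A] are bounded independently of the level, and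
    monotone convergence passes the bound to [f]. *)
Lemma convex_truncation_bounded (C : set (T -> R)) (e : R) :
  0 < e -> e <= 1 -> C !=set0 ->
  (forall f, C f -> measurable_fun setT f) ->
  (forall f, C f -> forall x, 0 <= f x) ->
  (forall f g t, C f -> C g -> 0 <= t <= 1 ->
    C (fun x => t * f x + (1 - t) * g x)) ->
  (forall f N, C f -> 0 <= N -> C (fun x => Num.min (f x) N)) ->
  (forall f, C f -> (P [set x | (1 <= f x)%R] <= e%:E)%E) ->
  exists A, [/\ measurable A, (P (~` A) <= (2 * e)%:E)%E &
    forall f, C f -> (\int[P]_(x in A) (f x)%:E <= 40%:E)%E].
Proof.
move=> e0 e1 [f0 Cf0] mC C0 Cconv Cmin Csmall.
pose i := ereal_inf [set I f | f in C].
have Ii f : C f -> (i <= I f)%E by move=> Cf; apply: ereal_inf_lbound; exists f.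
have i_ge0 : (0 <= i)%E.
  by apply: le_ereal_inf_tmp => _ [f Cf <-]; apply: I_ge0; exact: C0.
have i_fin : i \is a fin_num.
  rewrite ge0_fin_numE// (le_lt_trans (Ii _ Cf0))// (le_lt_trans (I_le1 _ _)) ?ltry//.
    exact: mC. exact: C0.
(* The [s n] add up to 1/4, the total decrease allowed for 1/(1 + X n) from 1/2 down to 1/4. The
   factor [s n ^+ 2 / 4] in [delta n] is the gain in [recip_midpoint]; dividing it out leaves
   probabilities that add up to [e]. *)
pose s n : R := (2 ^+ n.+3)^-1.
pose delta n : R := s n ^+ 2 / 4 * (e / (2 ^ n.+1)%:R).
have s_gt0 n : 0 < s n by rewrite invr_gt0 exprn_gt0.
have delta_gt0 n : 0 < delta n.
  by rewrite !mulr_gt0 ?exprn_gt0 ?invr_gt0 ?ltr0n ?expn_gt0.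
have /choice[X XP] : forall n, exists f, C f /\ (I f < i + (delta n)%:E)%E.
  move=> n; have [_ [f Cf <-] fi] := lb_ereal_inf_adherent (delta_gt0 n) i_fin.
  by exists f.

pose u n x := (1 + X n x)^-1.
have mX n : measurable_fun setT (X n) by apply: mC; exact: (XP n).1.
have X0 n x : 0 <= X n x by apply: C0; exact: (XP n).1.
have mu n : measurable_fun setT (u n) by exact: measurable_recip.
have u0 n x : 0 <= u n x by rewrite invr_ge0 addr_ge0.
have delta_le n : delta n.+1 <= delta n.
  apply: ler_pM.
  - by rewrite mulr_ge0// exprn_ge0// ltW.
  - by rewrite mulr_ge0// ltW.
  - rewrite ler_wpM2r// lerXn2r ?nnegrE ?ltW// ltf_pV2 ?posrE ?exprn_gt0//.
    by rewrite ltr_eXn2l ?ltr1n.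
  - rewrite ler_wpM2l ?ltW// ltf_pV2 ?posrE ?ltr0n ?expn_gt0//.
    by rewrite ltr_nat ltn_exp2l.
pose B n := [set x | s n <= `|u n x - u n.+1 x|].
have mB n : measurable (B n).
  rewrite /B -[mkset _]setTI; apply: measurable_fun_le => //.
  by apply: measurableT_comp => //; exact: measurable_funB.
(* The midpoint [M] of two successive near-minimizers lies in [C], hence [i <= I M]. On [B n] strict
   convexity gains [s n ^+ 2 / 4], and the total gain cannot exceed the error [delta n], which
   bounds the error of [X n.+1] as well. *)
have PB n : (P (B n) <= (e / (2 ^ n.+1)%:R)%:E)%E.
  have q0 : 0 < s n ^+ 2 / 4 by rewrite divr_gt0 ?exprn_gt0.
  set M := fun x => 2^-1 * X n x + (1 - 2^-1) * X n.+1 x.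
  have CM : C M by apply: Cconv; [exact: (XP n).1|exact: (XP n.+1).1|lra].
  have M0 x : 0 <= M x by exact: C0.
  have mM : measurable_fun setT (fun x => (1 + M x)^-1).
    by apply: measurable_recip => //; exact: mC.
  have M0' x : 0 <= (1 + M x)^-1 by rewrite invr_ge0 addr_ge0.
  rewrite -(@lee_pmul2l _ (s n ^+ 2 / 4)%:E) ?lte_fin// -EFinM -/(delta n).
  rewrite -(leeD2lE _ _ i_fin).
  apply: (@le_trans _ _ (I M + (s n ^+ 2 / 4)%:E * P (B n))%E).
    by rewrite leeD2r// Ii.
  apply: (@le_trans _ _ ((2^-1)%:E * I (X n) + (2^-1)%:E * I (X n.+1))%E); last first.
    apply: (@le_trans _ _ ((2^-1)%:E * (i + (delta n)%:E) + (2^-1)%:E * (i + (delta n)%:E))%E).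
      rewrite leeD// lee_pmul2l ?lte_fin ?invr_gt0// ltW ?(XP _).2//.
      by rewrite (lt_le_trans (XP _).2)// leeD2l// lee_fin.
    by rewrite -(fineK i_fin) -!EFinD lee_fin; lra.
  have -> : P (B n) = (\int[P]_x (\1_(B n) x)%:E)%E by rewrite integral_indic// setIT.
  rewrite -[I M]mul1e -!ge0_integral_lincomb//;
    try exact: ltW; try exact: mu; try exact: u0.
  apply: ge0_le_integral => //.
  - by move=> x _; rewrite lee_fin addr_ge0// mulr_ge0// ltW.
  - by apply/measurable_EFinP; apply: measurable_funD; apply: measurable_funM.
  - by apply/measurable_EFinP; apply: measurable_funD; apply: measurable_funM => //; exact: mu.

  move=> x _; rewrite lee_fin mul1r indicE.
  case: (boolP (x \in B n)) => [/[!inE] Bx|_]; rewrite ?mulr1 ?mulr0.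
    by apply: recip_midpoint => //; exact: ltW.
  (* Off [B n], the case of gain 0 is plain convexity. *)
  have := recip_midpoint (X0 n x) (X0 n.+1 x) (lexx 0) (normr_ge0 _).
  by rewrite expr0n/= mul0r.
pose D := [set x | (1 <= X 0%N x)%R].
have mD : measurable D.
  by rewrite /D -[mkset _]setTI; exact: measurable_fun_le.
pose A := ~` (D `|` \bigcup_n B n).
have mA : measurable A.
  by apply: measurableC; apply: measurableU => //; exact: bigcup_measurable.
(* The bound starts at 1/2, the value of 1/(1+x) at 1, and drops by exactly [s n] at each step; its
   limit 1/4 corresponds to [X n x <= 3]. *)
have uA x : A x -> forall n, 4^-1 + (2 ^+ n.+2)^-1 <= u n x.
  move=> Ax; elim=> [|n IHn].
    have x1 : X 0%N x < 1 by rewrite ltNge; apply/negP => Dx; apply: Ax; left.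
    rewrite (_ : _ + _ = 2^-1); last by rewrite expr2; field.
    by rewrite lef_pV2 ?posrE ?ltr_pwDl//; lra.
  have : `|u n x - u n.+1 x| < s n.
    by rewrite ltNge; apply/negP => Bx; apply: Ax; right; exists n.
  move/(le_lt_trans (ler_norm _)).
  have sn : s n = (2 ^+ n.+2)^-1 / 2 by rewrite /s exprSr invfM.
  by rewrite -/(s n) sn; lra.
have XA x : A x -> forall n, X n x <= 3.
  move=> Ax n; have := uA x Ax n; have := X0 n x.
  rewrite /u => Xx0 un; have : 4^-1 <= (1 + X n x)^-1.
    by apply: le_trans un; rewrite lerDl invr_ge0 exprn_ge0.
  by rewrite lef_pV2 ?posrE//; lra.
exists A; split => //.
  rewrite setCK (le_trans (measureU2 _ _ _))//; first exact: bigcup_measurable.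
  rewrite mulr2n mulrDl mul1r EFinD leeD//; first by apply: Csmall; exact: (XP 0%N).1.
  apply: le_trans (epsilon_trick0 xpredT (ltW e0)).
  apply: (le_trans (measure_sigma_subadditive _ mB _ _)) => //.
    exact: bigcup_measurable.
  by apply: lee_nneseries => // n _; exact: PB.
move=> f Cf.
have mf := mC _ Cf; have f_ge0 := C0 _ Cf.
have trunc n : (\int[P]_(x in A) (Num.min (f x) n.+1%:R)%:E <= 40%:E)%E.
  set N : R := n.+1%:R.
  have N1 : 1 <= N by rewrite ler1n.
  have N0 : 0 < N by lra.
  have Nv0 : 0 < N^-1 by rewrite invr_gt0.
  have Nv1 : N^-1 <= 1 by rewrite invf_le1.
  (* On [A] one has [X n x <= 3] and [Z x <= 4], so 1/20 is a lower bound for the inverse of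
     [(1 + X n x) * (1 + Z x)], as [recip_tangent] requires; off [A] the coefficient is 0. *)
  pose g x := 20^-1 * \1_A x * Num.min (f x) N.
  have min0 x : 0 <= Num.min (f x) N by rewrite le_min f_ge0 ltW.
  have g0 x : 0 <= g x by rewrite !mulr_ge0.
  have mg : measurable_fun setT g.
    by apply: measurable_funM; [exact: measurable_funM|exact: measurable_minr].
  set Z := fun x => N^-1 * Num.min (f x) N + (1 - N^-1) * X n x.
  have CZ : C Z.
    apply: Cconv; [exact: Cmin (ltW N0)|exact: (XP n).1|].
    by rewrite ltW.
  have mZ : measurable_fun setT (fun x => (1 + Z x)^-1).
    by apply: measurable_recip; [exact: mC|exact: C0].
  have Z0 x : 0 <= (1 + Z x)^-1 by rewrite invr_ge0 addr_ge0// C0.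
  (* The minimization error does not exceed the step length [N^-1]; after division by [N^-1], this
     error and the cost in [recip_tangent] contribute at most 1 each, whence the bound 2 and finally
     40 = 20 * 2. *)
  have deltaN : delta n <= N^-1.
    apply: (@le_trans _ _ (1 * (e / (2 ^ n.+1)%:R))).
      apply: ler_wpM2r; first by rewrite divr_ge0// ltW.
      have s1 : s n <= 1 by rewrite invf_le1 ?exprn_gt0// exprn_ege1// ler1n.
      have : s n ^+ 2 <= 1 by rewrite exprn_ile1// ltW.
      lra.
    rewrite mul1r (@le_trans _ _ (2 ^ n.+1)%:R^-1)//.
      by rewrite ler_piMl.
    by rewrite lef_pV2 ?posrE ?ltr0n ?expn_gt0// ler_nat ltnW// ltn_expl.
  clearbody N.
  (* Near-minimality of [X n] compared with the point [Z] obtained from it by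
     moving a step [N^-1] towards [min (f, N)]. *)
  have g2 : (\int[P]_x (g x)%:E <= 2%:E)%E.
    rewrite -(@lee_pmul2l _ (N^-1)%:E) ?lte_fin// -EFinM -(leeD2lE _ _ i_fin).
    apply: (@le_trans _ _ (1%:E * I Z + (N^-1)%:E * \int[P]_x (g x)%:E)%E).
      by rewrite mul1e leeD2r// Ii.
    apply: (@le_trans _ _ (1%:E * I (X n) + (N^-1)%:E * \int[P]_x (1%:E))%E).
      rewrite -!ge0_integral_lincomb//; try exact: ltW; try exact: mu; try exact: u0.
      apply: ge0_le_integral => //.
      - by move=> x _; rewrite lee_fin addr_ge0// mulr_ge0// ltW.
      - by apply/measurable_EFinP; apply: measurable_funD; apply: measurable_funM.
      - apply/measurable_EFinP; apply: measurable_funD => //.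
        by apply: measurable_funM => //; exact: mu.
      move=> x _; rewrite lee_fin !mul1r mulr1.
      apply: recip_tangent => //; first by rewrite ltW.
      rewrite -/(Z x).
      have Zx0 : 0 <= Z x by exact: C0.
      rewrite indicE; case: (boolP (x \in A)) => [/[!inE] Ax|_]; last first.
        by rewrite mulr0 invr_ge0 mulr_ge0// addr_ge0.
      have Xx := XA _ Ax n; have Xx0 := X0 n x.
      have minN : Num.min (f x) N <= N by rewrite ge_min lexx orbT.
      have Zx4 : Z x <= 4.
        have : N^-1 * Num.min (f x) N <= 1 by rewrite mulrC ler_pdivrMr// mul1r.
        have : (1 - N^-1) * X n x <= 1 * X n x by apply: ler_wpM2r => //; lra.
        by rewrite /Z; lra.
      by rewrite mulr1 lef_pV2 ?posrE ?mulr_gt0; nra.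
    have -> : (\int[P]_x 1%:E = 1%:E)%E.
      by rewrite integral_cst// mul1e; exact: probability_setT.
    rewrite mul1e mule1.
    apply: (@le_trans _ _ (i + (delta n)%:E + (N^-1)%:E)%E).
      by rewrite leeD2r// ltW// (XP n).2.
    by rewrite -addeA leeD2l// -EFinD lee_fin; lra.
  rewrite integral_mkcond.
  apply: (@le_trans _ _ (20%:E * \int[P]_x (g x)%:E)%E); last first.
    apply: (@le_trans _ _ (20%:E * 2%:E)%E); first by rewrite lee_pmul2l// lte_fin.
    by rewrite -EFinM lee_fin; lra.
  rewrite -ge0_integralZl//; last by move=> x _; rewrite lee_fin.
    apply: ge0_le_integral => //.
    - by move=> x _; rewrite patchE; case: ifP => // _; rewrite lee_fin.
    - by apply/(measurable_restrictT _ mA)/measurable_EFinP/measurable_funTS/measurable_minr.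
    - by apply: measurable_funeM; exact/measurable_EFinP.
    move=> x _; rewrite patchE /g indicE -EFinM; case: ifP => _.
      by rewrite lee_fin mulr1; lra.
    by rewrite lee_fin mulr0 mul0r mulr0.
  exact/measurable_EFinP.
have mmin n : measurable_fun A (fun x => (Num.min (f x) n.+1%:R)%:E).
  by apply/measurable_EFinP/measurable_funTS/measurable_minr.
have min_cvg x : (Num.min (f x) n.+1%:R)%:E @[n --> \oo] --> (f x)%:E.
  apply: cvg_near_cst; near=> n; congr EFin; apply/min_idPl.
  rewrite (@le_trans _ _ n%:R)// ?ler_nat//; near: n.
  exact: nbhs_infty_ger.
rewrite (eq_integral (fun x => limn (fun n => (Num.min (f x) n.+1%:R)%:E))); last first.
  by move=> x _; apply/esym/cvg_lim.
rewrite monotone_convergence//.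
- apply: lime_le; last exact: nearW.
  apply: ereal_nondecreasing_is_cvgn => m n mn; apply: ge0_le_integral => //.
  + by move=> x _; rewrite lee_fin le_min f_ge0 ler0n.
  + by move=> x _; rewrite lee_fin le_min2// ler_nat.
- by move=> n x _; rewrite lee_fin le_min f_ge0 ler0n.
- by move=> x _ m n mn; rewrite lee_fin le_min2// ler_nat.
Unshelve. all: by end_near. Qed.

End convex_truncation.

(** * Absolute continuity and construction of the equivalent measure *)

Section change_of_measure.
Context (d : measure_display) (T : measurableType d) (R : realType).
Implicit Types P Q : probability T R.

Lemma ae_le_measure P (A B : set T) : measurable A -> measurable B ->
  (\forall w \ae P, A w -> B w) -> (P A <= P B)%E.
Proof.
move=> mA mB [N [mN N0 subN]].
rewrite -[leRHS]adde0 -N0; apply: le_trans (measureU2 _ mB mN).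
apply: le_measure; rewrite ?inE//; first exact: measurableU.
move=> w Aw; have [Bw|nBw] := pselect (B w); [by left|right].
by apply: subN => /(_ Aw).
Qed.

(** This is continuity of the total variation of [Q], seen as a charge; the variation dominates
    [Q A]. *)
Lemma null_dominates_small P Q : Q `<< P -> forall e : R, 0 < e ->
  exists2 r : R, 0 < r & forall A, measurable A -> (P A < r%:E)%E -> (Q A < e%:E)%E.
Proof.
move=> QP e e0.
have [A0 [B0 hd]] := Hahn_decomposition (charge_of_finite_measure Q).
have [r [r0 h]] := @charge_variation_continuous _ _ _ _ _ _ hd P QP e e0.
exists r => // A mA PA; apply: le_lt_trans (h A mA PA).
apply: le_trans (abse_charge_variation hd mA).
exact: lee_abs.
Qed.

(** By uniqueness of densities, [h] agrees almost everywhere with the Radon-Nikodym derivative, for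
    which the change of variables is known. *)
Lemma integral_density P Q (h : T -> R) (f : T -> \bar R) :
  P.-integrable setT (EFin \o h) -> (forall x, 0 <= h x) ->
  (forall A, measurable A -> Q A = (\int[P]_(x in A) (h x)%:E)%E) ->
  measurable_fun setT f -> (forall x, (0 <= f x)%E) ->
  (\int[Q]_x f x = \int[P]_x (f x * (h x)%:E))%E.
Proof.
move=> ih h0 Qh mf f0.
have QP : Q `<< P.
  apply/null_content_dominatesP => A mA PA0.
  rewrite Qh//; apply: null_set_integral => //.
  exact: measurable_funTS (measurable_int _ ih).
rewrite -(Radon_Nikodym_SigmaFinite.change_of_variables QP)//.
set rn := Radon_Nikodym_SigmaFinite.f Q P.
have irn : P.-integrable setT rn by exact: Radon_Nikodym_SigmaFinite.f_integrable.
have rn0 x : (0 <= rn x)%E by exact: Radon_Nikodym_SigmaFinite.f_ge0.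
apply: ge0_ae_eq_integral => //.
- by apply: emeasurable_funM => //; exact: measurable_int irn.
- by apply: emeasurable_funM => //; exact: measurable_int ih.
- by move=> x _; rewrite mule_ge0.
- by move=> x _; rewrite mule_ge0// lee_fin.
apply: ae_eqe_mul2l.
apply: integral_ae_eq => //; first exact: measurable_int ih.
by move=> A _ mA; rewrite -Qh// -Radon_Nikodym_SigmaFinite.f_integral.
Qed.

Lemma density_probability P (g : T -> R) : measurable_fun setT g ->
  (forall x, 0 <= g x <= 1) -> (0 < \int[P]_x (g x)%:E)%E ->
  exists Q c, 0 < c /\
    forall A, measurable A -> Q A = (\int[P]_(x in A) (c * g x)%:E)%E.
Proof.
move=> mg g01 g_gt0.
have ig : P.-integrable setT (EFin \o g).
  apply: (@le_integrable _ _ _ P _ measurableT _ (cst 1%:E)) => //.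
  - exact/measurable_EFinP.
  - move=> x _ /=; rewrite lee_fin !ger0_norm//; by case/andP: (g01 x).
  - exact: finite_measure_integrable_cst.
have mu_ge0 E : (0 <= induced_charge ig E)%E.
  by apply: integral_ge0 => x _; rewrite lee_fin; case/andP: (g01 x).
pose mu := measure_of_charge (induced_charge ig) mu_ge0.
(* Here [P] is only the default value of [mnormalize] for total mass zero or infinite, which [mu_nz]
   excludes. *)
pose Q : probability T R := mnormalize mu P.
have muT : mu setT = (\int[P]_x (g x)%:E)%E by [].
have mu_fin : mu setT \is a fin_num by rewrite muT; exact: integrable_fin_num.
exists Q, (fine (mu setT))^-1; split.
  by rewrite invr_gt0 fine_gt0// muT g_gt0 -ge0_fin_numE -?muT// ltW// muT.
have mu_nz : ((mu setT == 0) || (mu setT == +oo))%E = false.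
  by apply/negbTE; rewrite negb_or muT gt_eqF//= -ltey -ge0_fin_numE -?muT// ltW// muT.
move=> A mA; change (mnormalize mu P A = (\int[P]_(x in A) ((fine (mu setT))^-1 * g x)%:E)%E).
rewrite /mnormalize mu_nz.
transitivity ((fine (mu setT))^-1%:E * \int[P]_(x in A) (g x)%:E)%E; first exact: muleC.
rewrite -ge0_integralZl_EFin//.
- by move=> x _; rewrite lee_fin; case/andP: (g01 x).
- exact/measurable_EFinP/measurable_funTS.
- by rewrite invr_ge0 fine_ge0.
Qed.

Lemma integral_eq0_negligible P (g : T -> R) A : measurable_fun setT g ->
  (forall x, 0 <= g x) -> (\forall x \ae P, 0 < g x) -> measurable A ->
  (\int[P]_(x in A) (g x)%:E = 0)%E -> P A = 0%E.
Proof.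
move=> mg g0 g_gt0 mA Ag0.
have /(ae_eq_integral_abs _ mA) Ag : (\int[P]_(x in A) `|(g x)%:E| = 0)%E.
  by rewrite -Ag0; apply: eq_integral => x _; rewrite gee0_abs ?lee_fin.
apply/eqP; rewrite -measure_le0 -(measure0 P); apply: ae_le_measure => //.
have /Ag : measurable_fun A (fun x => (g x)%:E).
  exact/measurable_EFinP/measurable_funTS.
by apply: filterS2 g_gt0 => x gx /[swap] Ax /(_ Ax)[] gx0; rewrite gx0 ltxx in gx.
Qed.

(** Each weight [h n] damps by [r n] the region off [A n]. A density proportional to the infimum of
    all these weights lies below a fixed multiple of each, so one measure and one constant [c] serve
    every [n]. *)
Lemma switch_probability P (A : nat -> set T) (r : nat -> R) :
  (forall n, measurable (A n)) -> (\sum_(n <oo) P (~` A n) < +oo)%E ->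
  (forall n, 0 < r n <= 1) ->
  exists (Q : probability T R) c, [/\ 0 < c, Q `<< P, P `<< Q &
    forall n (f : T -> \bar R), measurable_fun setT f -> (forall x, (0 <= f x)%E) ->
    (\int[Q]_x f x <=
     c%:E * (\int[P]_(x in A n) f x + (r n)%:E * \int[P]_x f x))%E].
Proof.
move=> mA sumA r01.
pose h n x : R := if x \in A n then 1 else r n.
have h_gt0 n x : 0 < h n x by rewrite /h; case: ifP => // _; case/andP: (r01 n).
have h_le1 n x : h n x <= 1 by rewrite /h; case: ifP => // _; case/andP: (r01 n).
have lbh x : has_lbound (range (h ^~ x)) by exists 0 => _ [n _ <-]; exact: ltW.
(* The tail infimum from index 0 is the infimum over all [n]; [infs] gives its measurability. *)
pose g x := infs (h ^~ x) 0.
have sdrop0 x : sdrop (h ^~ x) 0 = range (h ^~ x).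
  by apply/seteqP; split => [_ [n _ <-]|_ [n _ <-]]; exists n.
have g_le x n : g x <= h n x.
  by rewrite /g /infs/= sdrop0; apply: ge_inf => //; exists n.
have le_g x y : (forall n, y <= h n x) -> y <= g x.
  move=> yh; rewrite /g /infs/= sdrop0; apply: lb_le_inf; first by exists (h 0%N x), 0%N.
  by move=> _ [n _ <-].
have g0 x : 0 <= g x by apply: le_g => n; exact: ltW.
have g1 x : g x <= 1 by apply: le_trans (g_le x 0%N) _.
have mg : measurable_fun setT g.
  apply: measurable_fun_infs => // n; apply: measurable_fun_ifT => //.
  apply: (measurable_fun_bool true); rewrite (_ : _ @^-1` _ = A n) ?setTI//.
  by apply/seteqP; split => x /=; [move/set_mem|move/mem_set].
have g_gt0 : \forall x \ae P, 0 < g x.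
  exists (lim_sup_set (fun n => ~` A n)); split.
  - apply: bigcap_measurable => // k _; apply: bigcup_measurable => j _.
    exact: measurableC.
  - by apply: lim_sup_set_cvg0 => // n; exact: measurableC.
  (* If [x] belongs to [A n] for all [n >= m], then [h n x] equals 1 from [m] on, so the infimum is
     at least the minimum of 1 and finitely many positive [r k]. *)
  move=> x /= gx m _; apply: contrapT => Am; apply: gx.
  have [rho rho0 rho_r] : exists2 rho, 0 < rho & forall k, (k < m)%N -> rho <= r k.
    elim: (m) => [|k [rho rho0 IH]]; first by exists 1.
    exists (Num.min rho (r k)); first by rewrite lt_min rho0; case/andP: (r01 k).
    move=> j; rewrite ltnS leq_eqVlt => /predU1P[->|jk]; first by rewrite ge_min lexx orbT.
    by rewrite ge_min IH.
  apply: (@lt_le_trans _ _ (Num.min rho 1)); first by rewrite lt_min rho0/=.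
  apply: le_g => n; rewrite /h; case: ifPn => [_|]; first by rewrite ge_min lexx orbT.
  rewrite notin_setE => nA; have [mn|nm] := leqP m n; last by rewrite ge_min rho_r.
  by exfalso; apply: Am; exists n.
have [||Q [c [c0 Qg]]] := @density_probability P g mg.
- by move=> x; rewrite g0 g1.
- rewrite lt_neqAle integral_ge0 ?andbT; last by move=> x _; rewrite lee_fin.
  apply/eqP => /esym /(integral_eq0_negligible mg g0 g_gt0 measurableT).
  by rewrite probability_setT => /eqP; rewrite onee_eq0.
have cg0 x : 0 <= c * g x by rewrite mulr_ge0// ltW.
have mcg : measurable_fun setT (fun x => c * g x) by exact: measurable_funM.
have icg : P.-integrable setT (EFin \o (fun x => c * g x)).
  apply: (@le_integrable _ _ _ P _ measurableT _ (cst c%:E)) => //.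
  - exact/measurable_EFinP.
  - by move=> x _ /=; rewrite lee_fin !ger0_norm// ?ler_piMr// ltW.
  - exact: finite_measure_integrable_cst.
exists Q, c; split => //.
- apply/null_content_dominatesP => B mB PB; rewrite Qg//.
  by apply: null_set_integral => //; exact: measurable_funTS (measurable_int _ icg).
- apply/null_content_dominatesP => B mB QB.
  apply: (integral_eq0_negligible mcg) => //; last by rewrite -Qg.
  by apply: filterS g_gt0 => x gx; rewrite mulr_gt0.
move=> n f mf f0; rewrite (integral_density icg cg0 Qg mf f0).
have mfA : measurable_fun setT (f \_ (A n)).
  by apply/(measurable_restrictT _ (mA n))/measurable_funTS.
have fA0 x : (0 <= (f \_ (A n)) x)%E by rewrite patchE; case: ifP.
have r0 : 0 <= r n by case/andP: (r01 n) => /ltW.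
have mrf : measurable_fun setT (fun x => ((r n)%:E * f x)%E) by exact: measurable_funeM.
have rf0 x : (0 <= (r n)%:E * f x)%E by rewrite mule_ge0.
rewrite (integral_mkcond (A n)) -(ge0_integralZl_EFin P measurableT (fun x _ => f0 x) mf r0).
rewrite -(ge0_integralD P measurableT (fun x _ => fA0 x) mfA (fun x _ => rf0 x) mrf).
rewrite -ge0_integralZl_EFin//; last 3 first.
- by move=> x _; rewrite adde_ge0.
- exact: emeasurable_funD.
- exact: ltW.
apply: ge0_le_integral => //.
- by move=> x _; rewrite mule_ge0// lee_fin.
- by apply: emeasurable_funM => //; exact/measurable_EFinP.
- by apply: measurable_funeM; apply: emeasurable_funD => //; exact: measurable_funeM.
move=> x _; rewrite EFinM muleCA lee_pmul2l ?lte_fin//.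
apply: (@le_trans _ _ (f x * (h n x)%:E)%E); first by rewrite lee_wpmul2l// lee_fin.
rewrite /h patchE; case: ifP => _.
- by rewrite mule1 leeDl// mule_ge0.
- by rewrite add0e muleC.
Qed.

End change_of_measure.

(** * Comparison of convergence in probability with convergence in mean *)

Section L0_distance.
Context (d : measure_display) (T : measurableType d) (R : realType).
Variable P : probability T R.
Implicit Types X Y Z : L0 P.

(** Taken on [L0 P] with values in the extended reals, so that it makes sense before integrability
    is known. *)
Definition L1_dist X Y : \bar R := (\int[P]_w (`|X w - Y w|)%:E)%E.

Lemma measurable_L0_norm X : measurable_fun setT (fun w => `|X w|).
Proof. exact: measurableT_comp. Qed.

Lemma measurable_L0_normB X Y : measurable_fun setT (fun w => `|X w - Y w|).
Proof. by apply: measurableT_comp => //; exact: measurable_funB. Qed.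

Lemma L0_reprB X Y : (X - Y : L0 P) = X \- Y %[ae P].
Proof.
apply: filterS2 (L0_reprD X (- Y)) (L0_reprN Y) => w /(_ I) XY /(_ I) NY _.
by rewrite XY/= NY.
Qed.

Lemma L1_normBE X Y : ('N[P]_1[EFin \o (X - Y : L0 P)%R] = L1_dist X Y)%E.
Proof.
rewrite Lnorm1; apply: ge0_ae_eq_integral => //.
- by do 2 apply: measurableT_comp => //.
- by apply/measurable_EFinP; exact: measurable_L0_normB.
by apply: filterS (L0_reprB X Y) => w /(_ I) e _; rewrite /= e.
Qed.

Lemma L1_dist_le X Y : (L1_dist X Y <= 'N[P]_1[EFin \o X] + 'N[P]_1[EFin \o Y])%E.
Proof.
rewrite !Lnorm1 -ge0_integralD//; try by do 2 apply: measurableT_comp => //.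
apply: ge0_le_integral => //.
- by apply/measurable_EFinP; exact: measurable_L0_normB.
- by apply: emeasurable_funD; do 2 apply: measurableT_comp => //.
by move=> w _; rewrite -EFinD lee_fin ler_normB.
Qed.

(** Markov's inequality at level [e]. *)
Lemma L1_dist_ball X Y e : 0 < e -> (L1_dist X Y < (e * e)%:E)%E -> ball X e Y.
Proof.
move=> e0 XY; rewrite /ball/= /L0_ball/=.
rewrite -(@lte_pmul2l _ e%:E) ?lte_fin// -EFinM; apply: le_lt_trans XY.
have := @le_integral_abse _ _ _ P setT measurableT (EFin \o (fun w => X w - Y w)) e.
rewrite setTI; apply => //.
by apply/measurable_EFinP; exact: measurable_funB.
Qed.

Lemma L1_distE (x y : L1 P) : (`|x - y|%:E = L1_dist (L1val x) (L1val y))%E.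
Proof. by rewrite -L1_normBE; exact: L1_normE. Qed.

(** By Markov's inequality the norm topology is always the finer one, so agreement amounts to
    continuity on [K], at each point, of the identity from the topology of [L0 P] to the norm. *)
Lemma L0_L1_topologies_agreeP (K : set (L0 P)) :
  L0_L1_topologies_agree K <-> K `<=` range (@L1val d T R P) /\
  forall X e, K X -> 0 < e -> exists2 r, 0 < r &
    forall Y, K Y -> ball X r Y -> (L1_dist X Y < e%:E)%E.
Proof.
split=> [[KL1 agree]|[KL1 unif]]; split=> //.
  move=> X e KX e0; have [x _ xX] := KL1 _ KX.
  have [_ /(_ _)[]] := agree ((@L1val d T R P @` (ball x e)°) `&` K).
    by exists (ball x e)° => //; exact: open_interior.
  move=> U oU UK.
  have : (U `&` K) X.
    rewrite -UK; split => //; exists x => //.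
    by apply/nbhs_ballP; exists e.
  move=> [UX _]; have /nbhs_ballP[r /= r0 rU] : nbhs X U by exact: open_nbhs_nbhs.
  exists r => // Y KY XY.
  have : (U `&` K) Y by split => //; exact: rU.
  rewrite -UK => -[[y /interior_subset xy <-] _].
  rewrite -xX -L1_distE lte_fin.
  by move: xy; rewrite -ball_normE.
move=> A; split=> [[U oU ->]|[V oV ->]].
- exists (@L1val d T R P @^-1` U).
    rewrite openE => x /= Ux.
    have /nbhs_ballP[e /= e0 eU] : nbhs (L1val x) U by exact: open_nbhs_nbhs.
    apply/nbhs_ballP; exists (e * e); first by rewrite /= mulr_gt0.
    move=> y; rewrite -ball_normE /= => xy; apply: eU; apply: L1_dist_ball => //.
    by rewrite -L1_distE lte_fin.
  apply/seteqP; split=> X [].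
    by move=> UX KX; split => //; have [x _ xX] := KL1 _ KX; exists x => //=; rewrite xX.
  by move=> [x Ux <-] KX.
(* Adjoining the complement of [K] turns a relative neighborhood into a full one; the interior then
   has the required trace on [K]. *)
- exists ((@L1val d T R P @` V) `|` ~` K)°; first exact: open_interior.
  apply/seteqP; split=> X [].
    move=> [x Vx <-] KX; split => //.
    have /nbhs_ballP[e /= e0 eV] : nbhs x V by exact: open_nbhs_nbhs.
    have [r r0 rX] := unif _ _ KX e0.
    apply/nbhs_ballP; exists r => // Y XY.
    have [KY|nKY] := pselect (K Y); [left|by right].
    have [y _ yY] := KL1 _ KY; exists y => //; apply: eV.
    rewrite -ball_normE /= -lte_fin L1_distE yY.
    exact: rX.
  by move=> /interior_subset[].
Qed.

End L0_distance.

(** * Convex-solid sets of small elements are bounded in mean off a small event *)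

Section convex_solid_sets.
Context (d : measure_display) (T : measurableType d) (R : realType).
Variable P : probability T R.
Implicit Types X Y Z : L0 P.

Lemma exists_L0 (f : T -> R) : measurable_fun setT f ->
  exists X : L0 P, X = f %[ae P].
Proof.
move=> mf; pose m := isMeasurableFun.Build _ _ _ _ f mf.
pose g : {mfun T >-> R} := HB.pack f m.
by exists (L0_pi P g); exact: (L0_piK P g).
Qed.

(** Solidity puts the absolute values of [X] and [Y] in [W]; combining these instead of [X] and [Y]
    avoids cancellation. *)
Lemma convex_solid_comb (W : set (L0 P)) X Y (f g : T -> R) (t : R) :
  convex_solid W -> W X -> W Y -> 0 <= t <= 1 ->
  (\forall w \ae P, f w <= `|X w|) -> (\forall w \ae P, g w <= `|Y w|) ->
  exists2 Z, W Z & \forall w \ae P, t * f w + (1 - t) * g w <= `|Z w|.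
Proof.
move=> [Wconv Wsolid] WX WY /andP[t0 t1] fX gY.
have [U UX] := exists_L0 (measurable_L0_norm X).
have [V VY] := exists_L0 (measurable_L0_norm Y).
have WU : W U.
  by apply: Wsolid WX _; apply: filterS UX => w /(_ I) ->; rewrite normr_id.
have WV : W V.
  by apply: Wsolid WY _; apply: filterS VY => w /(_ I) ->; rewrite normr_id.
exists (t *: U + (1 - t) *: V).
  have := Wconv U V (Itv01 t0 t1); rewrite !inE => /(_ WU WV).
  exact.
have UV := L0_reprD (t *: U) ((1 - t) *: V).
have tU := L0_reprZ t U; have tV := L0_reprZ (1 - t) V.
near=> w.
have -> : (t *: U + (1 - t) *: V : L0 P) w = (t *: U : L0 P) w + ((1 - t) *: V : L0 P) w.
  by move: I; near: w.
have -> : (t *: U : L0 P) w = t * U w by move: I; near: w.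
have -> : ((1 - t) *: V : L0 P) w = (1 - t) * V w by move: I; near: w.
have -> : U w = `|X w| by move: I; near: w.
have -> : V w = `|Y w| by move: I; near: w.
apply: le_trans (ler_norm _).
by rewrite lerD// ler_wpM2l ?subr_ge0//; near: w.
Unshelve. all: by end_near. Qed.

Lemma convex_solid_L1_bounded (W : set (L0 P)) (e : R) :
  convex_solid W -> 0 < e -> e <= 1 -> W `<=` ball (0 : L0 P) e ->
  exists A, [/\ measurable A, (P (~` A) <= (2 * e)%:E)%E &
    forall X, W X -> (\int[P]_(w in A) (`|X w|)%:E <= (40 * e)%:E)%E].
Proof.
move=> csW e0 e1 We.
have [->|/set0P[X0 WX0]] := eqVneq W set0.
  by exists setT; split => //; rewrite setCT measure0 lee_fin mulr_ge0// ltW.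
(* Asking only for domination by an element of [W] makes [C] stable under truncation, and works with
   functions instead of classes. The factor [e] turns the level [e] of the ball into the level 1. *)
pose C := [set f : T -> R | [/\ measurable_fun setT f, forall x, 0 <= f x &
  exists2 X, W X & \forall w \ae P, e * f w <= `|X w|]].
have C_abs X : W X -> C (fun w => e^-1 * `|X w|).
  move=> WX; split.
  - by apply: measurable_funM => //; exact: measurable_L0_norm.
  - by move=> w; rewrite mulr_ge0// invr_ge0 ltW.
  - by exists X => //; apply: nearW => w; rewrite mulVKf// gt_eqF.
have [||||||A [mA PA AC]] := @convex_truncation_bounded _ _ _ P C e e0 e1.
- by exists (fun w => e^-1 * `|X0 w|); exact: C_abs.
- by move=> f [].
- by move=> f [].
- move=> f g t [mf f0 [X WX fX]] [mg g0 [Y WY gY]] t01; split.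
  + by apply: measurable_funD; apply: measurable_funM.
  + by case/andP: t01 => t0 t1 x; rewrite addr_ge0// mulr_ge0// subr_ge0.
  have [Z WZ fgZ] := convex_solid_comb csW WX WY t01 fX gY.
  exists Z => //; apply: filterS fgZ => w; apply: le_trans.
  by rewrite mulrDr !(mulrCA e).
- move=> f N [mf f0 [X WX fX]] N0; split.
  + exact: measurable_minr.
  + by move=> x; rewrite le_min f0.
  exists X => //; apply: filterS fX => w; apply: le_trans.
  by rewrite ler_wpM2l ?ge_min ?lexx// ltW.
- move=> f [mf f0 [X WX fX]].
  apply: le_trans (ltW (We _ WX)); apply: ae_le_measure.
  + by rewrite -[mkset _]setTI; exact: measurable_fun_le.
  + exact: measurable_L0_dist.
  apply: filterS2 fX (L0_repr0 P) => w fXw /(_ I) w0 /= f1.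
  by rewrite w0 sub0r normrN (le_trans _ fXw)// ler_peMr// ltW.
exists A; split => // X WX.
have -> : (\int[P]_(w in A) (`|X w|)%:E = e%:E * \int[P]_(w in A) (e^-1 * `|X w|)%:E)%E.
  rewrite -ge0_integralZl_EFin//; last 3 first.
  - by move=> w _; rewrite lee_fin mulr_ge0// invr_ge0 ltW.
  - apply/measurable_EFinP/measurable_funTS/measurable_funM => //.
    exact: measurable_L0_norm.
  - exact: ltW.
  by apply: eq_integral => w _; rewrite -EFinM mulVKf// gt_eqF.
by rewrite mulrC EFinM lee_pmul2l ?lte_fin//; apply: AC; exact: C_abs.
Qed.

End convex_solid_sets.

(** * Transfer of balls and distances between equivalent measures *)

Section L0_change.
Context (d : measure_display) (T : measurableType d) (R : realType).
Implicit Types P Q : probability T R.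

(** Balls of [L0] use one number both as level and as probability bound; the minimum of [e] and the
    radius from absolute continuity serves in both roles. *)
Lemma null_dominates_tail P Q : Q `<< P -> forall e : R, 0 < e ->
  exists2 r, 0 < r & forall f : T -> R, measurable_fun setT f ->
    (P [set w | (r <= f w)%R] < r%:E)%E -> (Q [set w | (e <= f w)%R] < e%:E)%E.
Proof.
move=> QP e e0; have [r r0 rQ] := null_dominates_small QP e0.
have mset (f : T -> R) (a : R) : measurable_fun setT f -> measurable [set w | (a <= f w)%R].
  by move=> mf; rewrite -[mkset _]setTI; exact: measurable_fun_le.
exists (Num.min r e); first by rewrite lt_min r0.
move=> f mf Pf; apply: rQ; first exact: mset.
apply: le_lt_trans (lt_le_trans Pf _); last by rewrite lee_fin ge_min lexx.
apply: le_measure; rewrite ?inE; [exact: mset|exact: mset|].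
by move=> w /=; apply: le_trans; rewrite ge_min lexx orbT.
Qed.

Lemma L0_change_distE P Q (X Y : L0 P) :
  (fun w => `|L0_change Q X w - L0_change Q Y w|) = (fun w => `|X w - Y w|) %[ae Q].
Proof.
apply: filterS2 (L0_piK Q X) (L0_piK Q Y) => w /(_ I) Xw /(_ I) Yw _.
by rewrite -Xw -Yw.
Qed.

Lemma L1_dist_change P Q (X Y : L0 P) :
  L1_dist (L0_change Q X) (L0_change Q Y) = (\int[Q]_w (`|X w - Y w|)%:E)%E.
Proof.
apply: ge0_ae_eq_integral => //.
- by apply/measurable_EFinP; exact: measurable_L0_normB.
- by apply/measurable_EFinP; exact: measurable_L0_normB.
by apply: filterS (L0_change_distE Q X Y) => w /[apply] ->.
Qed.

Lemma ball_change P Q (X Y : L0 P) e :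
  ball (L0_change Q X) e (L0_change Q Y) <->
  (Q [set w | (e <= `|X w - Y w|)%R] < e%:E)%E.
Proof.
rewrite /ball/= /L0_ball/=; split; apply: le_lt_trans; apply: ae_le_measure;
  try exact: measurable_L0_dist;
  by apply: filterS (L0_change_distE Q X Y) => w /(_ I) /= ->.
Qed.

End L0_change.

(** * The two implications and the equivalence *)

Section equivalence.
Context (d : measure_display) (T : measurableType d) (R : realType).
Implicit Types P Q : probability T R.

Lemma integral_norm_lincomb_le P Q (X Y : L0 P) (a b : R) : Q `<< P -> 0 <= a -> 0 <= b ->
  (\int[Q]_w (`|(a *: X + b *: Y : L0 P) w|)%:E <=
   a%:E * \int[Q]_w (`|X w|)%:E + b%:E * \int[Q]_w (`|Y w|)%:E)%E.
Proof.
move=> QP a0 b0.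
have mE (Z : L0 P) : measurable_fun setT (fun w => `|Z w|) by exact: measurable_L0_norm.
rewrite -ge0_integral_lincomb//.
apply: ae_ge0_le_integral => //.
- exact/measurable_EFinP.
- by move=> w _; rewrite lee_fin addr_ge0// mulr_ge0.
- by apply/measurable_EFinP; apply: measurable_funD; exact: measurable_funM.
have XY := null_dominates_ae_eq measurableT QP (L0_reprD (a *: X) (b *: Y)).
have aX := null_dominates_ae_eq measurableT QP (L0_reprZ a X).
have bY := null_dominates_ae_eq measurableT QP (L0_reprZ b Y).
near=> w => _.
have e1 : (a *: X + b *: Y : L0 P) w = (a *: X : L0 P) w + (b *: Y : L0 P) w.
  by move: I; near: w.
have e2 : (a *: X : L0 P) w = a * X w by move: I; near: w.
have e3 : (b *: Y : L0 P) w = b * Y w by move: I; near: w.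
rewrite lee_fin e1 e2 e3 (le_trans (ler_normD _ _))// !normrM.
by rewrite (ger0_norm a0) (ger0_norm b0).
Unshelve. all: by end_near. Qed.

Lemma L1_ball_convex_solid P Q (a : R) : Q `<< P ->
  convex_solid [set Z : L0 P | (\int[Q]_w (`|Z w|)%:E <= a%:E)%E].
Proof.
move=> QP; split.
- move=> X Y t /set_mem WX /set_mem WY; apply/mem_set.
  have t0 : 0 <= t%:num by [].
  have t1 : 0 <= 1 - t%:num by rewrite subr_ge0.
  apply: (le_trans (integral_norm_lincomb_le X Y QP t0 t1)).
  apply: (@le_trans _ _ (t%:num%:E * a%:E + (1 - t%:num)%:E * a%:E)%E).
    by rewrite leeD// lee_wpmul2l.
  by rewrite -!EFinM -EFinD lee_fin; lra.
- move=> X Y WX YX /=; apply: le_trans WX.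
  apply: ae_ge0_le_integral => //; try by apply/measurable_EFinP; exact: measurable_L0_norm.
  case: YX => N [mN N0 subN]; exists N; split => //.
    by move/null_content_dominatesP : QP; exact.
  by apply: subset_trans subN => w /= h XYw; apply: h => _; rewrite lee_fin.
Qed.

(** Uniformity comes from translation invariance of the norm: one ball of the norm under [Q] serves
    all [X], and only the radius of the neighborhood in [K] depends on [X]. *)
Lemma agree_uniformly_locally_convex_solid P Q (K : set (L0 P)) :
  Q `<< P -> P `<< Q -> L0_L1_topologies_agree (L0_change Q @` K) ->
  uniformly_locally_convex_solid K K.
Proof.
move=> QP PQ /L0_L1_topologies_agreeP[_ unif] U /nbhs_ballP[e /= e0 eU].
have [m m0 mP] := null_dominates_tail PQ e0.
(* Markov's inequality at level [m] then bounds the tail under [Q] by [m / 2], strictly below [m]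
   although the ball is closed. *)
have m20 : 0 < m * m / 2 by rewrite divr_gt0// mulr_gt0.
exists [set Z : L0 P | (\int[Q]_w (`|Z w|)%:E <= (m * m / 2)%:E)%E]; split.
- exact: L1_ball_convex_solid.
- move=> Z WZ; apply: eU; rewrite /ball/= /L0_ball/=.
  have mZ := measurable_L0_norm Z.
  apply: (@le_lt_trans _ _ (P [set w | (e <= `|Z w|)%R])).
    apply: ae_le_measure; first exact: measurable_L0_dist.
      by rewrite -[mkset _]setTI; exact: measurable_fun_le.
    by apply: filterS (L0_repr0 P) => w /(_ I) /= ->; rewrite sub0r normrN.
  apply: mP => //.
  have := @le_integral_abse _ _ _ Q setT measurableT (EFin \o Z) m.
  rewrite setTI => /(_ _ m0) Zm.
  rewrite -(@lte_pmul2l _ m%:E) ?lte_fin// -EFinM.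
  apply: le_lt_trans (Zm _) _; first exact/measurable_EFinP.
  by apply: le_lt_trans WZ _; rewrite lte_fin; lra.
- move=> X KX.
  have [r r0 rX] := unif _ _ (imageP (L0_change Q) KX) m20.
  have [s s0 sQ] := null_dominates_tail QP r0.
  apply/nbhs_ballP; exists s => // Y XY KY; split => //.
  have Q_XY : ball (L0_change Q X) r (L0_change Q Y).
    by apply/ball_change; apply: sQ => //; exact: measurable_L0_normB.
  have := rX _ (imageP _ KY) Q_XY; rewrite L1_dist_change => /ltW dXY.
  exists (Y - X); last by rewrite addrC subrK.
  apply: le_trans dXY => /=; rewrite le_eqVlt; apply/orP; left; apply/eqP.
  apply: ge0_ae_eq_integral => //.
  + by apply/measurable_EFinP; exact: measurable_L0_norm.
  + by apply/measurable_EFinP; exact: measurable_L0_normB.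
  have YX : _ = _ %[ae Q] := null_dominates_ae_eq measurableT QP (L0_reprB Y X).
  by apply: filterS YX => w /(_ I) -> _; rewrite distrC.
Qed.

Lemma uniformly_locally_convex_solid_agree P (K : set (L0 P)) :
  L1_bounded K -> uniformly_locally_convex_solid K K ->
  exists Q : probability T R,
    [/\ Q `<< P, P `<< Q & L0_L1_topologies_agree (L0_change Q @` K)].
Proof.
move=> Kbd ulcs.
have [M M0 KM] : exists2 M : R, 0 <= M &
    forall X, K X -> ('N[P]_1[EFin \o X] <= M%:E)%E.
  move: Kbd; rewrite /L1_bounded; set s := ereal_sup _ => s_fin.
  have Ks X : K X -> ('N[P]_1[EFin \o X] <= s)%E.
    move=> KX; apply: ereal_sup_ubound; exists X => //.
    by rewrite unlock Lnorm1.
  (* The maximum with 0 covers an empty [K], whose supremum is [-oo]. *)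
  exists (fine (maxe s 0)); first by rewrite fine_ge0// le_max lexx orbT.
  move=> X KX; rewrite fineK; first by rewrite (le_trans (Ks _ KX))// le_max lexx.
  by rewrite ge0_fin_numE ?le_max ?lexx ?orbT// gt_max s_fin ltry.
pose r n : R := (2 ^+ n)^-1.
have r_gt0 n : 0 < r n by rewrite invr_gt0 exprn_gt0.
have r_le1 n : r n <= 1 by rewrite invf_le1 ?exprn_gt0// exprn_ege1// ler1n.
(* The event [A n] comes from the set [W] alone, hence is common to all [X]; only the radius [s]
   varies with [X]. This is where uniformity enters. *)
have /choice[A AP] : forall n, exists A, [/\ measurable A, (P (~` A) <= (2 * r n)%:E)%E &
    forall X, K X -> exists2 s, 0 < s & forall Y, K Y -> ball X s Y ->
      (\int[P]_(w in A) (`|X w - Y w|)%:E <= (40 * r n)%:E)%E].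
  move=> n; have [W [csW Wr Wnbhs]] := ulcs _ (nbhsx_ballx (0 : L0 P) _ (r_gt0 n)).
  have [A [mA PA AW]] := convex_solid_L1_bounded csW (r_gt0 n) (r_le1 n) Wr.
  exists A; split => // X KX; have /nbhs_ballP[s /= s0 sW] := Wnbhs X KX.
  exists s => // Y KY XY; have [[Z WZ XZ] _] := sW _ XY KY.
  apply: le_trans (AW _ WZ); rewrite le_eqVlt; apply/orP; left; apply/eqP.
  apply: ge0_ae_eq_integral => //.
  - by apply/measurable_EFinP/measurable_funTS; exact: measurable_L0_normB.
  - by apply/measurable_EFinP/measurable_funTS; exact: measurable_L0_norm.
  apply: filterS (L0_reprD X Z) => w /(_ I) XZw _.
  by rewrite -XZ XZw /= opprD addrA subrr sub0r normrN.
have mA n : measurable (A n) by case: (AP n).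
have [||Q [c [c0 QP PQ Qint]]] := @switch_probability _ _ _ P A r mA.
(* The bounds [2 * r n] equal 4 / 2^(n+1) and add up to 4. *)
- apply: (@le_lt_trans _ _ 4%:E); last exact: ltry.
  apply: le_trans (@epsilon_trick0 R 4 xpredT _); last by [].
  apply: lee_nneseries => // n _; have [_ PA _] := AP n.
  by apply: le_trans PA _; rewrite lee_fin /r natrX exprS invfM; lra.
- by move=> n; rewrite r_gt0 r_le1.
exists Q; split => //; apply/L0_L1_topologies_agreeP; split.
  move=> _ [X KX <-].
  suff XL1 : L0_change Q X \in @L1_pred d T R Q by exists (MkL1 XL1).
  change (finite_norm Q 1 (L0_change Q X)).
  rewrite /finite_norm (@L1_norm_ae _ _ _ Q _ X (L0_piK Q X)) Lnorm1.
  have mX : measurable_fun setT (fun w => `|(EFin \o X) w|%E).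
    by do 2 apply: measurableT_comp => //.
  apply: le_lt_trans (Qint 0%N _ mX (fun w => abse_ge0 _)) _.
  apply: (@le_lt_trans _ _ (c%:E * (M%:E + (r 0%N)%:E * M%:E))%E).
    have XM := KM _ KX; rewrite Lnorm1 in XM.
    rewrite lee_pmul2l ?lte_fin// leeD//; last by rewrite lee_pmul2l ?lte_fin.
    by apply: le_trans XM; exact: ge0_subset_integral.
  by rewrite -!(EFinM, EFinD) ltry.
move=> _ e [X KX <-] e0.
(* On [A n] the distance contributes [40 * r n]; elsewhere the weight [r n] multiplies a mean
   distance of at most [2 * M]. *)
pose B := c * (40 + 2 * M).
have [n Bn] : exists n, B * r n < e.
  exists (Num.truncn (B / e)).+1; rewrite ltr_pdivrMr ?exprn_gt0// -ltr_pdivrMl//.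
  rewrite mulrC (lt_trans (truncnS_gt _))// -natrX ltr_nat ltn_expl//.
have [_ _ /(_ X KX)[s s0 sA]] := AP n.
have [t t0 tP] := null_dominates_tail PQ s0.
exists t => // _ [Y KY <-] /ball_change XY.
have {}XY : ball X s Y by apply: tP => //; exact: measurable_L0_normB.
rewrite L1_dist_change.
have mXY : measurable_fun setT (fun w => (`|X w - Y w|)%:E).
  by apply/measurable_EFinP; exact: measurable_L0_normB.
apply: le_lt_trans (Qint n _ mXY _) _ => //.
apply: (@le_lt_trans _ _ (c%:E * ((40 * r n)%:E + (r n)%:E * (M%:E + M%:E)))%E).
  rewrite lee_pmul2l ?lte_fin// leeD ?sA// lee_pmul2l ?lte_fin//.
  by apply: (le_trans (L1_dist_le X Y)); rewrite leeD ?KM.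
rewrite -!(EFinM, EFinD) lte_fin; apply: le_lt_trans Bn; rewrite /B; lra.
Qed.

End equivalence.

Theorem theorem1p4 (d : measure_display) (T : measurableType d) (R : realType)
    (P : probability T R) (P_nonatomic : nonatomic P)
    (K : set (L0 P)) (K_convex : @convex_set R (L0 P) K)
    (K_bounded : L1_bounded K) :
  uniformly_locally_convex_solid K K <->
  exists Q : probability T R,
    [/\ Q `<< P, P `<< Q & L0_L1_topologies_agree (L0_change Q @` K)].
Proof.
split; first exact: uniformly_locally_convex_solid_agree.
by move=> [Q [QP PQ]]; exact: agree_uniformly_locally_convex_solid.
Qed.
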